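(* Let $q_0, q_1, q_2$ be real polynomials in one variable such that $q_0(0)=0$, $q_0'(0)=1$, $q_1(0)=0$, and $q_2$ is not identically zero. Then the system $$\dot x = -y, \qquad \dot y = q_0(x) + q_1(x) y + q_2(x) y^2$$ commutes with no polynomial system nonproportional to it; that is, every real polynomial vector field commuting with the vector field of this system is a constant multiple of it.
   Context: Two planar vector fields $(p,q)$ and $(r,s)$ (equivalently, the systems $\dot x=p,\ \dot y=q$ and $\dot x=r,\ \dot y=s$) commute if their Lie bracket vanishes identically, i.e. $$r p_x + s p_y - p r_x - q r_y = 0, \qquad r q_x + s q_y - p s_x - q s_y = 0.$$ *)

(* Defs.v *)
From HB Require Import structures.
From mathcomp Require Import all_boot all_order all_algebra.
From mathcomp Require Import reals.

Set Implicit Arguments.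
Unset Strict Implicit.
Unset Printing Implicit Defensive.

Import GRing.Theory.
Local Open Scope ring_scope.

(* R[x, y] is {poly {poly R}}, read as R[x][y]: the outer indeterminate 'X is
   y, the inner one 'X%:P is x, and a one-variable q gives q(x) as q%:P.
   This is the opposite of the naming of 'X and 'Y in polyXY. *)

Definition derx (R : nzRingType) (f : {poly {poly R}}) : {poly {poly R}} :=
  map_poly (@deriv R) f.

Definition dery (R : nzRingType) (f : {poly {poly R}}) : {poly {poly R}} :=
  f^`().

(* The pair (p, q) stands for the system x' = p(x, y), y' = q(x, y). *)
Definition polysys (R : nzRingType) : Type :=
  ({poly {poly R}} * {poly {poly R}})%type.

Definition commute_sys (R : nzRingType) (V W : polysys R) : Prop :=
  let: (p, q) := V in
  let: (r, s) := W in
  r * derx p + s * dery p - p * derx r - q * dery r = 0 /\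
  r * derx q + s * dery q - p * derx s - q * dery s = 0.

Definition quadratic_sys (R : nzRingType) (q0 q1 q2 : {poly R}) : polysys R :=
  (- 'X, q0%:P + q1%:P * 'X + q2%:P * 'X^2).

Definition scale_sys (R : nzRingType) (c : R) (V : polysys R) : polysys R :=
  (c%:P *: V.1, c%:P *: V.2).

(* Main.v *)
Require Import Defs.
From HB Require Import structures.
From mathcomp Require Import all_boot all_order all_algebra.
From mathcomp Require Import reals.
From mathcomp Require Import ring zify.

Set Implicit Arguments.
Unset Strict Implicit.
Unset Printing Implicit Defensive.

(* Write D for the derivation along the system and Q for its second component.
   A field (r, s) commutes with the system iff s = - D r and
   D^2 r - Q_y D r + Q_x r = 0, an equation solved by r = y because the system
   commutes with itself. If r has degree n in y with top coefficient u(x), the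
   coefficient of y^(n+2) is
     u'' - (2n-1) q2 u' + n(n-1) q2^2 u - (n-1) q2' u = 0,
   and comparing degrees in x forces n <= 1. For n = 1 it reads u'' = q2 u', so
   u is constant, and subtracting u y leaves r = b(x). Then (b' + q2 b)' = 0
   makes b constant, so that D b = 0 and Q_x b = 0. As q0'(0) = 1, Q_x <> 0 and
   b = 0. *)

Import GRing.Theory.
Local Open Scope ring_scope.

Section Derx.
Variable R : nzRingType.
Implicit Types (f g : {poly {poly R}}) (c : R).

Lemma coef_derx f k : (derx f)`_k = (f`_k)^`().
Proof. by rewrite coef_map. Qed.

Lemma derx0 : derx (0 : {poly {poly R}}) = 0.
Proof. by apply/polyP=> k; rewrite coef_derx !coef0 deriv0. Qed.

Lemma derxD f g : derx (f + g) = derx f + derx g.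
Proof. by apply/polyP=> k; rewrite !(coefD, coef_derx) derivD. Qed.

Lemma derxN f : derx (- f) = - derx f.
Proof. by apply/polyP=> k; rewrite !(coefN, coef_derx) derivN. Qed.

Lemma derxZ c f : derx (c%:P *: f) = c%:P *: derx f.
Proof. by apply/polyP=> k; rewrite !(coefZ, coef_derx) !mul_polyC derivZ. Qed.

Lemma derxX : derx ('X : {poly {poly R}}) = 0.
Proof. by apply/polyP=> k; rewrite coef_derx coefX coef0 derivMn derivC mul0rn. Qed.

Lemma derxC (b : {poly R}) : derx b%:P = (b^`())%:P.
Proof.
by apply/polyP=> k; rewrite coef_derx !coefC; case: eqP; rewrite // deriv0.
Qed.

End Derx.

Section PolyODE.
Variable R : numDomainType.
Implicit Types (q u : {poly R}).

Lemma deriv_eq0_size u : u^`() = 0 -> (size u <= 1)%N.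
Proof.
move=> du; apply/leq_sizeP=> [[|k] // _].
have /eqP := congr1 (fun p : {poly R} => p`_k) du.
by rewrite coef_deriv coef0 Num.Theory.mulrn_eq0 /= => /eqP.
Qed.

Lemma size_mul_deriv_lt q u : q != 0 -> u != 0 ->
  (size (u^`()) < size (q * u)%R)%N.
Proof.
move=> q0 u0; have sq : (0 < size q)%N by rewrite size_poly_gt0.
have -> : size (q * u) = (size q + size u).-1 by exact: size_mul.
have : (size (u^`())%R < size u)%N by exact: lt_size_deriv.
by lia.
Qed.

(* If [n > 1], then [q ^+ 2 * u] has coefficient [n * (n - 1) != 0] and a larger
   degree than every other term. *)
Lemma top_coef_exponent (n : nat) q u : q != 0 -> u != 0 ->
  u^`()^`() - (q * u^`()) *+ (n + n) + q * u^`()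
    + (q ^+ 2 * u) *+ (n * n) - (q ^+ 2 * u) *+ n
    - (q^`() * u) *+ n + q^`() * u = 0 ->
  (n <= 1)%N.
Proof.
move=> q0 u0 E; rewrite leqNgt; apply/negP=> n1.
have sq : (0 < size q)%N by rewrite size_poly_gt0.
have su : (0 < size u)%N by rewrite size_poly_gt0.
have nn : (n * n.-1)%:R != 0 :> R.
  by rewrite Num.Theory.pnatr_eq0; case: n n1 {E} => [|[|]].
have big : size ((q ^+ 2 * u) *+ (n * n.-1)) = (size q + size q + size u - 2)%N.
  rewrite -scaler_nat size_scale //.
  have -> : size (q ^+ 2 * u) = (size (q * q)%R + size u).-1.
    by apply: size_mul; rewrite ?expf_neq0.
  have -> : size (q * q) = (size q + size q).-1 by exact: size_mul.
  by lia.
set N := (_ - 2)%N in big.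
have smallM (v : {poly R}) k : (size v < N)%N -> (size (v *+ k) < N)%N.
  by apply: leq_ltn_trans; rewrite -scaler_nat size_scale_leq.
have smallD (v w : {poly R}) :
    (size v < N)%N -> (size w < N)%N -> (size (v + w)%R < N)%N.
  by move=> hv hw; apply: leq_ltn_trans (size_polyD _ _) _; rewrite gtn_max hv.
have du : (size (u^`())%R < size u)%N by exact: lt_size_deriv.
have dq : (size (q^`())%R < size q)%N by exact: lt_size_deriv.
have ddu : (size (u^`()^`())%R < N)%N.
  by apply: leq_ltn_trans (size_poly _ _) _; rewrite /N; lia.
have qdu : (size (q * u^`())%R < N)%N.
  by apply: leq_ltn_trans (size_polyMleq _ _) _; rewrite /N; lia.
have dqu : (size (q^`() * u)%R < N)%N.
  by apply: leq_ltn_trans (size_polyMleq _ _) _; rewrite /N; lia.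
have eq_top : (q ^+ 2 * u) *+ (n * n.-1) =
    - (u^`()^`()) + (q * u^`()) *+ (n + n) - q * u^`() + (q^`() * u) *+ n - q^`() * u.
  apply/eqP; rewrite -subr_eq0 -E; apply/eqP.
  by case: (n) n1 => [//|m _]; rewrite [_.-1]/=; ring.
have : (size ((q ^+ 2 * u) *+ (n * n.-1))%R < N)%N.
  by rewrite eq_top; do !apply/smallD; rewrite ?size_polyN //; apply/smallM.
by rewrite big ltnn.
Qed.

End PolyODE.

Section BracketEquation.
Variable R : numDomainType.
Implicit Types (Q f g r s : {poly {poly R}}).

Definition der_along Q f : {poly {poly R}} := - 'X * derx f + Q * dery f.

Definition commutant_op Q f : {poly {poly R}} :=
  der_along Q (der_along Q f) - dery Q * der_along Q f + derx Q * f.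

Lemma commutant_opP Q r s :
  commute_sys (- 'X, Q) (r, s) -> s = - der_along Q r /\ commutant_op Q r = 0.
Proof.
rewrite /commute_sys => -[E1 E2].
have sE : s = - der_along Q r.
  move: E1; rewrite derxN derxX /der_along {1}/dery derivN derivX oppr0 mulr0 => E1.
  by apply/eqP; rewrite -subr_eq0 -oppr_eq0 -E1; apply/eqP; ring.
split=> //; rewrite /commutant_op -E2 sE {1}/der_along.
rewrite derxN [dery (- _)]derivN -/(dery _); ring.
Qed.

Lemma der_alongD Q f g : der_along Q (f + g) = der_along Q f + der_along Q g.
Proof. rewrite /der_along derxD /dery derivD; ring. Qed.

Lemma der_alongZ Q (c : R) f : der_along Q (c%:P *: f) = c%:P *: der_along Q f.
Proof. by rewrite /der_along derxZ /dery derivZ scalerDr !scalerAr. Qed.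

Lemma der_alongX Q : der_along Q 'X = Q.
Proof. by rewrite /der_along derxX /dery derivX mulr0 add0r mulr1. Qed.

Lemma commutant_opD Q f g :
  commutant_op Q (f + g) = commutant_op Q f + commutant_op Q g.
Proof. rewrite /commutant_op !der_alongD; ring. Qed.

(* The field commutes with itself, and its first component is - y. *)
Lemma commutant_opZX Q (c : R) : commutant_op Q (c%:P *: 'X) = 0.
Proof.
rewrite /commutant_op !der_alongZ der_alongX -!mul_polyC /der_along; ring.
Qed.

Section Quadratic.
Variables q0 q1 q2 : {poly R}.
Let Q := q0%:P + q1%:P * 'X + q2%:P * 'X^2.

Lemma size_der_along f n :
  (size f <= n.+1)%N -> (size (der_along Q f) <= n.+2)%N.
Proof.
move=> sf; apply/leq_sizeP => -[|[|j]] //; rewrite 2!ltnS => nj.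
have f0 k : (n < k)%N -> f`_k = 0 by move=> nk; exact/(leq_sizeP _ _ sf).
rewrite /der_along /Q !mulrDl -!mulrA mulNr !coefD coefN coefXM !coefCM.
rewrite !coefXM /= coef_derx !coef_deriv !f0; try by lia.
by rewrite deriv0 !mul0rn !mulr0 oppr0 !addr0.
Qed.

Lemma coef_der_along_top f n : (size f <= n.+1)%N ->
  (der_along Q f)`_n.+1 = - (f`_n)^`() + (q2 * f`_n) *+ n.
Proof.
move=> sf; have f0 k : (n < k)%N -> f`_k = 0.
  by move=> nk; exact/(leq_sizeP _ _ sf).
rewrite /der_along /Q !mulrDl -!mulrA mulNr !coefD coefN coefXM !coefCM.
rewrite !coefXM /= coef_derx !coef_deriv (f0 n.+2) ?(f0 n.+1) //.
rewrite !mul0rn !mulr0 !add0r; case: n {sf f0} => [|n] /=.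
  by rewrite mulr0 mulr0n.
by rewrite mulrnAr.
Qed.

Lemma coef_commutant_op_top f n : (size f <= n.+1)%N ->
  (commutant_op Q f)`_n.+2 =
  (f`_n)^`()^`() - (q2 * (f`_n)^`()) *+ (n + n) + q2 * (f`_n)^`()
  + (q2 ^+ 2 * f`_n) *+ (n * n) - (q2 ^+ 2 * f`_n) *+ n
  - (q2^`() * f`_n) *+ n + q2^`() * f`_n.
Proof.
move=> sf; have f0 k : (n < k)%N -> f`_k = 0.
  by move=> nk; exact/(leq_sizeP _ _ sf).
have sDf := size_der_along sf; have topDf := coef_der_along_top sf.
rewrite /commutant_op coefD coefB coef_der_along_top // topDf.
have -> : dery Q = q1%:P + (q2 *+ 2)%:P * 'X.
  rewrite /dery /Q !derivE polyCMn; ring.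
have -> : derx Q = (q0^`())%:P + (q1^`())%:P * 'X + (q2^`())%:P * 'X^2.
  apply/polyP=> k; rewrite coef_derx /Q !coefD !coefCM !coefC coefX coefXn.
  by case: k => [|[|[|k]]]; rewrite /= ?mulr0 ?mulr1 ?addr0 ?add0r ?deriv0.
rewrite !mulrDl -!mulrA !coefD !coefCM !coefXM /=.
rewrite (f0 n.+1) // (f0 n.+2) // topDf.
rewrite (leq_sizeP _ _ sDf) // !mulr0 !add0r derivD derivN derivMn derivM.
ring.
Qed.

Lemma commutant_op_eq0 f : q0^`() != 0 -> q2 != 0 ->
  commutant_op Q f = 0 -> exists c : R, f = c%:P *: 'X.
Proof.
move=> dq0 q2n0 Lf0.
have sf : (size f <= 2)%N.
  have [->|fn0] := eqVneq f 0; first by rewrite size_poly0.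
  have sf : size f = (size f).-1.+1 by rewrite prednK // size_poly_gt0.
  have fn : f`_(size f).-1 != 0 by rewrite -lead_coefE lead_coef_eq0.
  rewrite sf ltnS; apply: (top_coef_exponent q2n0 fn).
  by rewrite -(coef_commutant_op_top (f := f)) ?Lf0 ?coef0 // -sf.
have df1 : (f`_1)^`() = 0.
  apply/eqP/negPn/negP => df1n0.
  have E : (f`_1)^`()^`() = q2 * (f`_1)^`().
    apply/eqP; rewrite -subr_eq0; apply/eqP.
    transitivity ((0 : {poly {poly R}})`_3); last by rewrite coef0.
    rewrite -Lf0 coef_commutant_op_top //; ring.
  by have := size_mul_deriv_lt q2n0 df1n0; rewrite E ltnn.
have f1E : f`_1 = ((f`_1)`_0)%:P by apply/size1_polyC/deriv_eq0_size.
set c := _`_0 in f1E; exists c; set b := f`_0.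
have fE : f = c%:P *: 'X + b%:P.
  apply/polyP=> -[|[|k]]; rewrite coefD coefZ coefX coefC /= ?mulr0 ?add0r //.
    by rewrite mulr1 addr0 -f1E.
  by apply/(leq_sizeP _ _ sf).
suff b0 : b = 0 by rewrite fE b0 addr0.
have Lb : commutant_op Q b%:P = 0.
  by move: Lf0; rewrite fE commutant_opD commutant_opZX add0r.
apply/eqP/negPn/negP => bn0.
have sb : (size (b^`() + q2 * b)%R <= 1)%N.
  apply: deriv_eq0_size; transitivity ((0 : {poly {poly R}})`_2); last by rewrite coef0.
  rewrite -Lb (@coef_commutant_op_top _ 0) ?size_polyC ?leq_b1 //.
  rewrite coefC /= derivD derivM; ring.
have db : b^`() = 0.
  have lt_b := size_mul_deriv_lt q2n0 bn0.
  move: sb; rewrite addrC size_polyDl // => sb.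
  by apply/eqP; rewrite -size_poly_leq0 -ltnS (leq_trans lt_b).
move: Lb; rewrite /commutant_op.
have -> : der_along Q b%:P = 0.
  by rewrite /der_along derxC db [dery _]derivC mulr0 mulr0 addr0.
rewrite [der_along _ 0]/der_along derx0 [dery 0]deriv0 !mulr0 addr0 subr0 add0r.
move/eqP; rewrite mulf_eq0 polyC_eq0 (negPf bn0) orbF => /eqP dQ.
have := congr1 (fun g : {poly {poly R}} => g`_0) dQ.
rewrite /= coef0 coef_derx /Q !coefD !coefCM !coefC coefX coefXn !mulr0 !addr0.
by move/eqP; rewrite (negPf dq0).
Qed.

End Quadratic.
End BracketEquation.

Theorem theorem6 (R : realType) (q0 q1 q2 : {poly R})
    (hq0 : q0.[0] = 0) (hq0' : q0^`().[0] = 1) (hq1 : q1.[0] = 0)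
    (hq2 : q2 != 0) (W : polysys R) :
  commute_sys (quadratic_sys q0 q1 q2) W ->
  exists c : R, W = scale_sys c (quadratic_sys q0 q1 q2).
Proof.
case: W => r s /commutant_opP [-> Lr].
have dq0 : q0^`() != 0.
  by apply/eqP=> E; move: hq0'; rewrite E horner0 => /eqP; rewrite eq_sym oner_eq0.
have [c ->] := commutant_op_eq0 dq0 hq2 Lr.
exists (- c); rewrite /scale_sys /= der_alongZ der_alongX polyCN.
by rewrite scalerN !scaleNr opprK.
Qed.
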